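(* The conjugacy relation of pointed Cantor systems with the specification property is Borel bi-reducible with $=^+$.
   Context: A pointed Cantor system with the specification property is a triple $(C,\varphi,x)$ where $C$ is the Cantor set, $\varphi\in\mathrm{Homeo}(C)$ is such that $(C,\varphi)$ has the specification property, and $x\in C$ has dense forward orbit $\{\varphi^n(x):n\ge0\}$. These are coded by pairs $(\varphi,x)$ in a Borel subset of $\mathrm{Homeo}(C)\times C$, where $\mathrm{Homeo}(C)$ has the compact-open topology. $(C,\varphi,x)$ and $(C,\psi,y)$ are conjugate if there is $\rho\in\mathrm{Homeo}(C)$ with $\rho\varphi=\psi\rho$ and $\rho(x)=y$. Specification property: a system $(X,\tau)$ ($X$ compact with metric $d$, $\tau$ a homeomorphism) has the specification property if for every $\varepsilon>0$ there is $k\in\mathbb N$ such that for all $n\ge 2$, all $x_1,\dots,x_n\in X$ and all integers $0\le a_1<b_1$, $a_2<b_2,\dots,a_n<b_n$ with $a_i-b_{i-1}\ge k$ for $2\le i\le n$, there is $y\in X$ with $d(\tau^j(x_i),\tau^j(y))\le\varepsilon$ for all $1\le i\le n$ and $a_i\le j<b_i$. $=^+$ is the equivalence relation on $\mathbb R^{\mathbb N}$ given by $(x_n)=^+(y_n)$ if and only if $\{x_n:n\in\mathbb N\}=\{y_n:n\in\mathbb N\}$. An equivalence relation $E$ on a standard Borel space $Z_1$ is Borel-reducible to $F$ on $Z_2$ if there is a Borel map $f\colon Z_1\to Z_2$ with $z\mathrel{E}z'\iff f(z)\mathrel{F}f(z')$ for all $z,z'\in Z_1$; bi-reducible means reducible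 in both directions. *)

(* Defs.v *)
From HB Require Import structures.
From mathcomp Require Import all_boot all_order all_algebra finmap.
From mathcomp Require Import all_classical all_reals all_analysis.

Set Implicit Arguments.
Unset Strict Implicit.
Unset Printing Implicit Defensive.

Import Order.TTheory GRing.Theory Num.Theory.
Import numFieldNormedType.Exports.

Local Open Scope classical_set_scope.
Local Open Scope ring_scope.

(* The Cantor set is [cantor_space], i.e. bool^nat with the product topology.
   The library does not give it a metric; [cantor_dist x y] is 2^-n for the
   least n with x n != y n, and 0 if there is none ([sup set0 = 0]). *)
Definition cantor_dist (R : realType) (x y : cantor_space) : R :=
  sup [set 2^-1 ^+ n | n in [set n : nat | x n != y n]].

Section CantorMetric.
Variable R : realType.
Implicit Types x y z : cantor_space.
Local Notation dist := (@cantor_dist R).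

Lemma cantor_dist_ub x y n : x n != y n -> 2^-1 ^+ n <= dist x y.
Proof.
move=> xy; apply: ub_le_sup; last by exists n.
exists 1 => _ [m _ <-]; apply: exprn_ile1; first by rewrite invr_ge0 ler0n.
by rewrite invf_le1 ?ltr0n // ler1n.
Qed.

Lemma cantor_dist_le x y (c : R) : 0 <= c ->
  (forall n, x n != y n -> 2^-1 ^+ n <= c) -> dist x y <= c.
Proof.
move=> c0 h; rewrite /cantor_dist.
set D := (X in sup X); have [->|/set0P ne] := eqVneq D set0.
  by rewrite sup0.
by apply: (ge_sup ne) => _ [n xy <-]; exact: h.
Qed.

Lemma cantor_distxx x : dist x x = 0.
Proof.
rewrite /cantor_dist (_ : [set _ | _ in _] = set0) ?sup0 // -subset0.
by move=> t [n /=]; rewrite eqxx.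
Qed.

Lemma cantor_dist_ge0 x y : 0 <= dist x y.
Proof.
have [[n xy]|xy] := pselect (exists n, x n != y n).
  by apply: le_trans (cantor_dist_ub xy); rewrite exprn_ge0 ?invr_ge0 ?ler0n.
have -> : x = y; last by rewrite cantor_distxx.
by apply: funext => n; apply/eqP/negPn/negP => h; apply: xy; exists n.
Qed.

Lemma cantor_dist_sym x y : dist x y = dist y x.
Proof. by congr sup; congr image; apply/funext => n /=; rewrite eq_sym. Qed.

Lemma cantor_dist_triangle y x z : dist x z <= dist x y + dist y z.
Proof.
apply: cantor_dist_le; first by rewrite addr_ge0 ?cantor_dist_ge0.
move=> n xz; have [xy|xy] := eqVneq (x n) (y n).
  by apply: ler_wpDl; rewrite ?cantor_dist_ge0 // cantor_dist_ub // -xy.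
by apply: ler_wpDr; rewrite ?cantor_dist_ge0 // cantor_dist_ub.
Qed.

Lemma cantor_dist_positivity x y : dist x y = 0 -> x = y.
Proof.
move=> xy0; apply: funext => n; apply/eqP/negPn/negP => /cantor_dist_ub.
by rewrite xy0 leNgt exprn_gt0 ?invr_gt0 ?ltr0n.
Qed.

Let ball x (e : R) : set cantor_space := [set y | dist x y < e].

Let ball_center x e : 0 < e -> ball x e x.
Proof. by rewrite /ball /= cantor_distxx. Qed.

Let ball_sym x y e : ball x e y -> ball y e x.
Proof. by rewrite /ball /= cantor_dist_sym. Qed.

Let ball_triangle x y z e1 e2 :
  ball x e1 y -> ball y e2 z -> ball x (e1 + e2) z.
Proof.
by move=> h1 h2; apply: le_lt_trans (cantor_dist_triangle y x z) (ltrD h1 h2).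
Qed.

Lemma cantor_entourage_coord (i : nat) :
  entourage [set xy : cantor_space * cantor_space | xy.1 i = xy.2 i].
Proof.
pose T := prod_topology (fun _ : nat => bool).
pose V : set (T * T) := [set xy | xy.1 i = xy.2 i].
have entV : `[< @entourage
    (Uniform.Pack (Uniform.class (initial_topology (@proj _ (fun _ : nat => bool) i)))) V >].
  apply/asboolP; exists [set b | b.1 = b.2] => //.
  by rewrite uniform_discrete => _ [b _ <-].
exists V => //.
exists [fset exist (fun p : {classic nat} * set (T * T) =>
  `[< @entourage (Uniform.Pack (Uniform.class (initial_topology (@proj _ (fun _ : nat => bool) p.1)))) p.2 >]) (i, V) entV]%fset.
  by move=> ? _; exact: in_setT.
by rewrite set_fset1 bigcap_set1.
Qed.

Let ball_entourage : entourage = entourage_ ball.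
Proof.
rewrite eqEsubset; split => [E [B [F _ <-] FE]|E [e /= e0 eE]].
  pose N := \max_(p <- enum_fset F) (sval p).1.
  exists (2^-1 ^+ N); first by rewrite /= exprn_gt0 ?invr_gt0 ?ltr0n.
  move=> [x y] /= xy; apply: FE => p pF.
  have [W entW WE] : @entourage
     (initial_topology (@proj _ (fun _ : nat => bool) (sval p).1)) (sval p).2.
    by have := svalP p => /asboolP.
  apply: WE => /=.
  suff xyp : x (sval p).1 = y (sval p).1.
    have := entourage_refl (x (sval p).1) entW.
    by rewrite [in X in W (_, X)]xyp.
  apply/eqP/negPn/negP => /cantor_dist_ub; rewrite leNgt => /negP; apply.
  apply: lt_le_trans xy _.
  apply: ler_wiXn2l; rewrite ?invr_ge0 ?ler0n // ?invf_le1 ?ltr0n ?ler1n //.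
  exact: leq_bigmax_seq.
have [N Ne] : exists N, (2^-1 : R) ^+ N < e.
  have /cvgrPdist_lt /(_ e e0) [N _ /(_ N (leqnn N))] :
      (fun n => (2^-1 : R) ^+ n) @ \oo --> (0 : R).
    by apply: cvg_expr; rewrite gtr0_norm ?invr_gt0 ?ltr0n // invf_lt1 ?ltr1n ?ltr0n.
  by rewrite sub0r normrN ger0_norm ?exprn_ge0 ?invr_ge0 ?ler0n // => h; exists N.
apply: filterS eE _.
apply: (@filterS _ _ _ (\bigcap_(i in [set` [fset j in iota 0 N]%fset])
   [set xy : cantor_space * cantor_space | xy.1 i = xy.2 i])).
  move=> [x y] /= xy; rewrite /ball /=; apply: le_lt_trans Ne.
  apply: cantor_dist_le; first by rewrite exprn_ge0 ?invr_ge0 ?ler0n.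
  move=> n; have [nN|nN] := ltnP n N.
    by rewrite [x n]xy ?eqxx //= in_fset /= mem_iota.
  by move=> _; apply: ler_wiXn2l; rewrite ?invr_ge0 ?ler0n // ?invf_le1 ?ltr0n ?ler1n.
by apply: filter_bigI => i _; exact: cantor_entourage_coord.
Qed.

HB.instance Definition _ := Uniform_isPseudoMetric.Build R cantor_space
  ball_center ball_sym ball_triangle ball_entourage.

Let ballEmdist x d : pseudometric_structure.ball x d = [set y | dist x y < d].
Proof. by []. Qed.

HB.instance Definition _ := PseudoMetric_isMetric.Build R cantor_space
  cantor_dist_ge0 cantor_dist_positivity ballEmdist.

End CantorMetric.

Definition homeomorphism (X Y : topologicalType) (f : X -> Y) : Prop :=
  continuous f /\ exists g : Y -> X, [/\ cancel f g, cancel g f & continuous g].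

(* Homeo(X), a subspace of X -> X with the compact-open topology. *)
Definition homeo (X : topologicalType) : Type :=
  set_type [set f : {compact-open, X -> X} | homeomorphism f].

HB.instance Definition _ (X : topologicalType) := Topological.on (homeo X).

Definition homeo_fun (X : topologicalType) (f : homeo X) : X -> X := \val f.
Coercion homeo_fun : homeo >-> Funclass.

(* The integers 0 <= a_1 < b_1, a_2 < b_2, ... with b_(i-1) + k <= a_i are all
   nonnegative, so they are taken in nat. *)
Definition specification (R : realType) (X : metricType R) (tau : X -> X)
    : Prop :=
  forall eps : R, 0 < eps -> exists k : nat,
  forall (n : nat) (x : 'I_n -> X) (a b : 'I_n -> nat), (2 <= n)%N ->
    (forall i, a i < b i)%N ->
    (forall i j : 'I_n, j = i.+1 :> nat -> b i + k <= a j)%N ->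
  exists y : X, forall (i : 'I_n) (j : nat), (a i <= j < b i)%N ->
    mdist (iter j tau (x i)) (iter j tau y) <= eps.

Definition forward_orbit (X : Type) (tau : X -> X) (x : X) : set X :=
  range (fun n : nat => iter n tau x).

(* The codes (phi, x) of pointed Cantor systems with specification. *)
Definition pointed_spec_systems (R : realType)
    : set (homeo cantor_space * cantor_space) :=
  [set p : homeo cantor_space * cantor_space |
    @specification R cantor_space p.1 /\ dense (forward_orbit p.1 p.2)].

Definition pointed_conjugate (X : topologicalType) (p q : homeo X * X) : Prop :=
  exists rho : homeo X, (rho : X -> X) \o p.1 = (q.1 : X -> X) \o rho /\
    rho p.2 = q.2.

Definition eq_plus (R : realType) (x y : {ptws nat -> R}) : Prop :=
  range x = range y.

Definition borel (X : topologicalType) : set (set X) := <<s @open X >>.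

(* Borel reducibility of the relation E on the standard Borel space A, a Borel
   subset of X, to the relation F on the Borel subset B of Y.  In the intended
   use X and Y are Polish.  A Borel map from A to B is given by any f : X -> Y
   extending it; the Borel sets of A are the Borel sets of X contained in A. *)
Definition borel_reducible (X Y : topologicalType) (A : set X)
    (E : X -> X -> Prop) (B : set Y) (F : Y -> Y -> Prop) : Prop :=
  [/\ borel A, borel B &
      exists f : X -> Y,
        [/\ forall U, borel U -> borel (A `&` f @^-1` U),
            forall z, A z -> B (f z) &
            forall z z', A z -> A z' -> (E z z' <-> F (f z) (f z'))]].

Definition borel_bireducible (X Y : topologicalType) (A : set X)
    (E : X -> X -> Prop) (B : set Y) (F : Y -> Y -> Prop) : Prop :=
  borel_reducible A E B F /\ borel_reducible B F A E.

(* Main.v *)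
Require Import Defs.
From mathcomp Require Import all_boot all_order all_algebra.
From mathcomp Require Import all_classical all_reals all_analysis.
From mathcomp Require Import lra zify.
Import numFieldNormedType.Exports.
Local Open Scope classical_set_scope.

Set Implicit Arguments.
Unset Strict Implicit.
Unset Printing Implicit Defensive.
Import Order.TTheory GRing.Theory Num.Theory.

(** In a pointed system [(phi, x)] with dense forward orbit, a clopen set [U] is
    determined by its set of return times [{n | phi^n x \in U}], and an
    equivariant homeomorphism matching the base points transports clopen sets
    to clopen sets with the same return times.  Conversely, if two pointed
    systems have the same countable family of sets of return times, the return
    times of the coordinate sets define continuous maps in both directions that
    match the two orbits; by density they are inverse to each other and
    equivariant.  So conjugacy is equality of two countable sets of subsets of
    [nat], and coding subsets of [nat] by reals gives a continuous reduction to
    [=^+] ([pointed_conjugate_return_codes]).  The set of codes is Borel because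
    specification only needs to be tested on the countably many points with
    finitely many nonzero coordinates ([specificationP]).

    For the other reduction the homeomorphism is always the shift of
    [{0, 1}^(nat * int)] along [int], which has the specification property
    ([shift_specification]); only the base point varies.  There are sets [A_t]
    of integers, for [t] in [R * nat], any finitely many of which jointly
    realize every finite pattern at some nonnegative position
    ([free_set_pattern]).  A sequence [x] of reals is first turned into an
    enumeration without repetition [t_0, t_1, ...] of [range x `*` setT], by
    repeating all its terms infinitely often and tagging each with the number
    of its earlier occurrences; the base point has the sets [A_(t_n)] as rows.
    Its forward orbit is dense.  If two sequences have the same range, the base
    points differ by a permutation of the rows, which commutes with the shift.
    If some [r] occurs only in the first, then the nonnegative part of
    [A_(r, 0)] is the set of return times to a clopen set for the first base
    point, but not for the second, since its patterns are independent of all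
    rows of the second
    ([shift_point_conj_range]). *)

(** * Borel sets and Borel maps to countable sets *)

Section Borel.
Context {X : topologicalType}.
Implicit Types A B : set X.

Lemma borel_open A : open A -> borel A.
Proof. exact: sub_sigma_algebra. Qed.

Lemma borelC A : borel A -> borel (~` A).
Proof. by move=> bA; have := sigma_algebraCD bA; rewrite setTD. Qed.

Lemma borelT : borel [set: X].
Proof. by apply: borel_open; exact: openT. Qed.

Lemma borel_exists (T : countType) (A : T -> set X) :
  (forall t, borel (A t)) -> borel [set x | exists t, A t x].
Proof.
move=> bA.
rewrite (_ : [set _ | _] =
    \bigcup_n (if unpickle n is Some t then A t else set0)).
  apply: sigma_algebra_bigcup => n; case: unpickle => [t|]; first exact: bA.
  exact: sigma_algebra0.
apply/seteqP; split=> x /= => [[t At]|[n _]].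
  by exists (pickle t) => //; rewrite pickleK.
by case: unpickle => [t At|//]; exists t.
Qed.

Lemma borel_forall (T : countType) (A : T -> set X) :
  (forall t, borel (A t)) -> borel [set x | forall t, A t x].
Proof.
move=> bA; rewrite (_ : [set _ | _] = ~` [set x | exists t, (~` A t) x]).
  by apply: borelC; apply: borel_exists => t; exact: borelC.
apply/seteqP; split=> x /= => [h [t]|h t]; first by apply; exact: h.
by apply: contrapT => nAt; apply: h; exists t.
Qed.

Lemma borelI A B : borel A -> borel B -> borel (A `&` B).
Proof.
move=> bA bB; rewrite (_ : _ `&` _ =
    [set x | forall b : bool, (if b then A else B) x]).
  by apply: borel_forall => -[].
by apply/seteqP; split=> [x [Ax Bx] []//|x /= h]; split;
  [exact: (h true)|exact: (h false)].
Qed.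

Lemma borel_imply (P : Prop) A : (P -> borel A) -> borel [set x | P -> A x].
Proof.
have [p bA|np _] := pselect P.
  rewrite (_ : [set _ | _] = A); first exact: bA.
  by apply/seteqP; split=> x /=; auto.
rewrite (_ : [set _ | _] = setT); first exact: borelT.
by apply/seteqP; split=> x //= _ /np.
Qed.

(** Borel measurability of a map to a countable discrete set. *)
Definition borel_map (T : Type) (h : X -> T) :=
  forall P : set T, borel (h @^-1` P).

Lemma borel_map_fiber (T : countType) (h : X -> T) :
  (forall t, borel [set x | h x = t]) -> borel_map h.
Proof.
move=> bh P; rewrite (_ : _ @^-1` _ = [set x | exists t, P t /\ h x = t]).
  apply: borel_exists => t.
  have [Pt|nPt] := pselect (P t).
    rewrite (_ : (fun x => _) = [set x | h x = t]); first exact: bh.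
    by apply/seteqP; split=> x /=; [case|].
  rewrite (_ : (fun x => _) = set0); first exact: sigma_algebra0.
  by apply/seteqP; split=> x //= -[].
by apply/seteqP; split=> x /= => [Phx|[t [Pt ->]]//]; exists (h x).
Qed.

Lemma borel_map_comp (T U : Type) (g : T -> U) (h : X -> T) :
  borel_map h -> borel_map (g \o h).
Proof. by move=> bh P; rewrite comp_preimage; exact: bh. Qed.

Lemma borel_map_cst (T : Type) (t : T) : borel_map (fun=> t).
Proof.
move=> P; have [Pt|nPt] := pselect (P t).
  by rewrite (_ : _ @^-1` _ = setT); [exact: borelT|apply/seteqP; split].
rewrite (_ : _ @^-1` _ = set0); first exact: sigma_algebra0.
by apply/seteqP; split.
Qed.

Lemma borel_map_pair (T U : countType) (g : X -> T) (h : X -> U) :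
  borel_map g -> borel_map h -> borel_map (fun x => (g x, h x)).
Proof.
move=> bg bh; apply: borel_map_fiber => -[t u].
rewrite (_ : [set _ | _] = g @^-1` [set t] `&` h @^-1` [set u]).
  by apply: borelI; [exact: bg|exact: bh].
by apply/seteqP; split=> x /=; [case|case=> -> ->].
Qed.

Lemma borel_map_mkseq (T : countType) (h : X -> nat -> T) n :
  (forall i, borel_map (h^~ i)) -> borel_map (fun x => mkseq (h x) n).
Proof.
move=> bh; elim: n => [|n IHn].
  exact: borel_map_cst.
rewrite (_ : (fun x => _) =
    (fun q => rcons q.1 q.2) \o (fun x => (mkseq (h x) n, h x n))).
  by apply: borel_map_comp; exact: borel_map_pair.
by apply/funext => x; rewrite /= mkseqS.
Qed.

Lemma borel_map_continuous (h : X -> bool) : continuous h -> borel_map h.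
Proof.
move=> /continuousP ch P; apply: borel_open; apply: ch; exact: discrete_open.
Qed.

End Borel.

Lemma borel_preimage (X Y : topologicalType) (f : X -> Y) (U : set Y) :
  (forall V, open V -> borel (f @^-1` V)) -> borel U -> borel (f @^-1` U).
Proof.
move=> bf bU; apply: (bU [set V | borel (f @^-1` V)]); split=> //.
by split=> [|A bA|F bF] /=; [exact: sigma_algebra0|rewrite setTD; exact: borelC|
  rewrite preimage_bigcup; exact: sigma_algebra_bigcup].
Qed.

(** * The topology of the Cantor space and of its homeomorphism group *)

(** Two points of the Cantor space agree on their first [m] coordinates; the
    sets [[set d | agree m c d]] form a basis of clopen neighbourhoods. *)
Definition agree (m : nat) (c d : nat -> bool) : Prop :=
  forall i, (i < m)%N -> c i = d i.

Lemma agree_sym m c d : agree m c d -> agree m d c.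
Proof. by move=> cd i /cd. Qed.

Lemma agree_trans m c d e : agree m c d -> agree m d e -> agree m c e.
Proof. by move=> cd de i im; rewrite cd // de. Qed.

Lemma agree_le m n c d : (m <= n)%N -> agree n c d -> agree m c d.
Proof. by move=> mn cd i im; apply: cd; exact: leq_trans mn. Qed.

Lemma cantor_cvg (F : set_system cantor_space) (c : cantor_space) :
  Filter F -> (forall i, \forall d \near F, d i = c i) -> F --> c.
Proof.
move=> FF Fc; apply/(@pointwise_cvgP nat bool F c) => i A /= Ac.
apply: (@filterS _ F FF _ _ _ (Fc i)) => d /= ->; exact: nbhs_singleton.
Qed.

Lemma cantor_coord_near (c : cantor_space) i : \forall d \near c, d i = c i.
Proof.
apply: (@proj_continuous nat (fun=> bool) i c [set c i]).
exact: discrete_set1.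
Qed.

Lemma near_agree m (c : cantor_space) : \forall d \near c, agree m c d.
Proof.
elim: m => [|m IHm]; first by exact: filterE.
near=> d => i; rewrite ltnS leq_eqVlt => /orP[/eqP ->|im].
  by rewrite (near (cantor_coord_near c m) d).
by rewrite (near IHm d).
Unshelve. all: by end_near. Qed.

Lemma nbhs_cantorP (c : cantor_space) (A : set cantor_space) :
  nbhs c A <-> exists m, forall d, agree m c d -> A d.
Proof.
split=> [cA|[m mA]]; last by near=> d; apply: mA; near: d; exact: near_agree.
apply: contrapT => /forallNP nA.
have {}nA m : exists d : cantor_space, agree m c d /\ ~ A d.
  by have /existsNP[d /not_implyP] := nA m; exists d.
pose u m := xget c [set d : cantor_space | agree m c d /\ ~ A d].
have uP m : agree m c (u m) /\ ~ A (u m).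
  exact: (xgetPex c (nA m)).
have uc : u @ \oo --> c.
  apply: cantor_cvg => i; exists i.+1 => // m /= im.
  by rewrite (uP m).1.
by have [m _ /(_ m (leqnn m))] := uc _ cA; exact: (uP m).2.
Unshelve. all: by end_near. Qed.

Lemma continuous_boolP (X : topologicalType) (g : X -> bool) :
  continuous g <-> forall x, \forall y \near x, g y = g x.
Proof.
split=> [cg x|cg x A gxA]; first exact: (cg x _ (discrete_set1 (g x))).
by apply: filterS (cg x) => y /= ->; exact: nbhs_singleton.
Qed.

Lemma continuous_coord i : continuous (fun c : cantor_space => c i).
Proof. by apply/continuous_boolP => c; exact: cantor_coord_near. Qed.

Lemma continuous_cantorP (X : topologicalType) (h : X -> cantor_space) :
  continuous h <-> forall i, continuous (fun x => h x i).
Proof.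
split=> [ch i x|ch x].
  exact: (continuous_comp (ch x) (@continuous_coord i (h x))).
apply: cantor_cvg => i.
by have /continuous_boolP := ch i; exact.
Qed.

(** By compactness, a continuous map to a discrete set depends on finitely
    many coordinates only. *)
Lemma cantor_bool_unif (g : cantor_space -> bool) : continuous g ->
  exists m, forall c d : cantor_space, agree m c d -> g c = g d.
Proof.
move=> /continuous_boolP cg.
have /compact_near_coveringP/(_ nat \oo
    (fun m c => forall d : cantor_space, agree m c d -> g c = g d)) :=
  cantor_space_compact.
case=> [c _|m _ /(_ m (leqnn m)) gm].
  have /nbhs_cantorP[m gm] := cg c.
  exists ([set d | agree m c d], [set n | m <= n]%N) => /=.
    by split; [exact: near_agree|exists m].
  move=> -[d n] /= [cd mn] e de; rewrite gm // gm //.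
  by apply: agree_trans cd _; exact: agree_le de.
by exists m => c d; exact: gm.
Qed.

Lemma nbhs_clopen (U : set cantor_space) c : nbhs c U ->
  exists g : cantor_space -> bool,
    [/\ continuous g, g c & forall d, g d -> U d].
Proof.
move=> /nbhs_cantorP[m mU]; exists (fun d => `[< agree m c d >]); split.
- apply/continuous_boolP => d; apply: filterS (near_agree m d) => e de.
  apply: asbool_equiv_eq; split=> ce; first exact: agree_trans (agree_sym de).
  exact: agree_trans de.
- exact/asboolP.
- by move=> d /asboolP/mU.
Qed.

Lemma homeo_continuous (X : topologicalType) (f : homeo X) :
  continuous (f : X -> X).
Proof. by have [] : homeomorphism (f : X -> X) := set_mem (valP f). Qed.

(** A homeomorphism as an element of [homeo X]. *)
Definition mk_homeo (X : topologicalType) (f : X -> X)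
    (hf : homeomorphism f) : homeo X :=
  exist _ (f : {compact-open, X -> X}) (mem_set hf).

(** Evaluation is jointly continuous for the compact-open topology. *)
Lemma continuous_eval :
  continuous (fun p : homeo cantor_space * cantor_space =>
    (p.1 : cantor_space -> cantor_space) p.2).
Proof.
move=> [f c] U /= /nbhs_clopen[g [cg gfc gU]].
(* If [g] is the indicator of a clopen subset of [U], the compact clopen set
   [K] of the points where [g \o f] is true contains [c], and it is mapped into
   [U] by all the maps sending [K] into [g @^-1` [set true]], which form a
   neighbourhood of [f]. *)
pose F : cantor_space -> cantor_space := homeo_fun f.
pose K := (g \o F) @^-1` [set true].
have cgf : continuous (g \o F).
  by move=> d; apply: continuous_comp; [exact: homeo_continuous|exact: cg].
have cK : compact K.
  apply: (subclosed_compact _ cantor_space_compact) => //.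
  by have /continuous_closedP := cgf; apply; exact: discrete_closed.
have oO : open (g @^-1` [set true]).
  by have /continuousP := cg; apply; exact: discrete_open.
pose W : set {compact-open, cantor_space -> cantor_space} :=
  [set h | h @` K `<=` g @^-1` [set true]].
have oW : open W by exact: compact_open_open.
pose V : set (homeo cantor_space) := \val @^-1` W.
have nV : nbhs (f : homeo cantor_space) V.
  apply: open_nbhs_nbhs; split; first by exists W.
  by move=> _ /= [d Kd <-].
exists (V, K) => /=.
  split=> //; apply: (cgf c [set true]); rewrite /= gfc; exact: discrete_set1.
by move=> [h d] /= [hK Kd]; apply: gU; apply: hK; exists d.
Qed.

Lemma continuous_iter_eval (X : topologicalType)
    (f : X -> homeo cantor_space) (c : X -> cantor_space) n :
  continuous f -> continuous c ->
  continuous (fun x => iter n (f x : cantor_space -> cantor_space) (c x)).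
Proof.
move=> cf cc; elim: n => [|n IHn]; first exact: cc.
move=> x /=.
apply: (@continuous2_cvg _ _ _ _ _ _ _ _
  (fun (h : homeo cantor_space) (d : cantor_space) =>
    (h : cantor_space -> cantor_space) d)); last 2 first.
- exact: cf.
- exact: IHn.
exact: (@continuous_eval (f x, _)).
Qed.

Lemma mdist_agree (R : realType) (c d : cantor_space) m :
  (@mdist R cantor_space c d <= 2^-1 ^+ m)%R <-> agree m c d.
Proof.
split=> [cd i im|cd].
  apply/eqP/negPn/negP => /(@cantor_dist_ub R).
  apply/negP; rewrite -ltNge; apply: le_lt_trans cd _.
  by rewrite ltr_iXn2l ?invr_gt0 ?invf_lt1 ?ltr1n ?ltr0n.
apply: cantor_dist_le => [|i]; first by rewrite exprn_ge0 ?invr_ge0.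
have [im|mi _] := ltnP i m; first by rewrite cd ?eqxx.
by rewrite ler_iXn2l ?invr_gt0 ?invf_lt1 ?ltr1n ?ltr0n.
Qed.

(** * Coding subsets of the natural numbers by real numbers *)

Section BitCode.
Variable R : realType.
Local Open Scope ring_scope.
Implicit Types b c : nat -> bool.

Let psum b n : R := \sum_(i < n) (b i)%:R * 3^-1 ^+ i.

(** The real number [\sum_i b i / 3 ^ i]; since a nonzero digit outweighs all
    the later ones, it determines [b]. *)
Definition bitcode b : R := sup (range (psum b)).

Let psumS b n : psum b n.+1 = psum b n + (b n)%:R * 3^-1 ^+ n.
Proof. by rewrite /psum big_ord_recr. Qed.

Let third_gt0 n : 0 < 3^-1 ^+ n :> R.
Proof. by rewrite exprn_gt0 ?invr_gt0 ?ltr0n. Qed.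

Let psum_agree n b c : agree n b c -> psum b n = psum c n.
Proof. by move=> bc; apply: eq_bigr => i _; rewrite bc. Qed.

Let psum_mono b n m : psum b n <= psum b (n + m)%N.
Proof.
elim: m => [|m IHm]; first by rewrite addn0.
by rewrite addnS psumS (le_trans IHm)// lerDl mulr_ge0 ?ler0n ?ltW.
Qed.

(* The bound [3 / 2 * 3^-1 ^+ n] is the sum of [3^-1 ^+ i] over [i >= n]. *)
Let psum_tail b n m :
  psum b (n + m)%N + 3 / 2 * 3^-1 ^+ (n + m) <= psum b n + 3 / 2 * 3^-1 ^+ n.
Proof.
elim: m => [|m IHm]; first by rewrite addn0.
rewrite addnS psumS exprS; apply: le_trans IHm.
have := third_gt0 (n + m); case: (b _) => /=; lra.
Qed.

Let psum_bound b n m : psum b m <= psum b n + 3 / 2 * 3^-1 ^+ n.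
Proof.
have [nm|/ltnW mn] := leqP n m.
  rewrite -(subnKC nm); apply: le_trans (psum_tail b n (m - n)).
  by have := third_gt0 (n + (m - n)); lra.
have := psum_mono b m (n - m); rewrite subnKC//.
by have := third_gt0 n; lra.
Qed.

Let bitcode_le b n : bitcode b <= psum b n + 3 / 2 * 3^-1 ^+ n.
Proof.
apply: ge_sup => [|_ [m _ <-]]; first by exists (psum b 0), 0%N.
exact: psum_bound.
Qed.

Let bitcode_ge b n : psum b n <= bitcode b.
Proof.
apply: ub_le_sup; last by exists n.
by exists (psum b 0 + 3 / 2 * 3^-1 ^+ 0) => _ [m _ <-]; exact: psum_bound.
Qed.

Let bitcode_lt b c n : agree n b c -> ~~ b n -> c n -> bitcode b < bitcode c.
Proof.
move=> /psum_agree bc /negbTE bn cn.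
have := bitcode_le b n.+1; have := bitcode_ge c n.+1.
rewrite !psumS bn cn bc exprS /=; have := third_gt0 n; lra.
Qed.

Lemma bitcode_inj : injective bitcode.
Proof.
move=> b c bc; apply/funext => n; elim/ltn_ind: n => n IHn.
have nbc : agree n b c by move=> i /IHn.
have := bitcode_lt (agree_sym nbc); have := bitcode_lt nbc.
rewrite bc ltxx; case: (b n) (c n) => [] [] // h1 h2.
  by have := h2 isT isT.
by have := h1 isT isT.
Qed.

Lemma bitcode_continuous (X : topologicalType) (b : X -> nat -> bool) :
  (forall n, continuous (fun x => b x n)) ->
  continuous (fun x => bitcode (b x)).
Proof.
move=> cb x; apply/cvgrPdist_le => e e0.
have [n ne] : exists n, 3 / 2 * 3^-1 ^+ n <= e.
  have /cvgrPdist_le /(_ (e / 2)) : (3^-1 ^+ n : R) @[n --> \oo] --> (0 : R).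
    by apply: cvg_expr; rewrite gtr0_norm ?invr_gt0 ?invf_lt1 ?ltr1n ?ltr0n.
  move=> /(_ ltac:(lra)) [n _ /(_ n (leqnn n))].
  rewrite sub0r normrN (ger0_norm (ltW (third_gt0 n))) => ne; exists n; lra.
have nb : \forall y \near x, agree n (b x) (b y).
  elim: n {ne} => [|n IHn]; first exact: filterE.
  have /continuous_boolP/(_ x) := cb n.
  apply: filterS2 IHn => y xy yn i; rewrite ltnS leq_eqVlt => /orP[/eqP ->//|].
  exact: xy.
apply: filterS nb => y /psum_agree xy.
have := bitcode_ge (b x) n; have := bitcode_le (b x) n.
have := bitcode_ge (b y) n; have := bitcode_le (b y) n.
by rewrite xy ler_distl => *; apply/andP; split; lra.
Qed.

End BitCode.

(** * Return times and pointed conjugacy *)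

(** The clopen set of the points that have a prefix in the list [d]. *)
Definition cell (d : seq (seq bool)) (c : nat -> bool) : bool :=
  has (fun w => mkseq c (size w) == w) d.

Lemma continuous_has (X : topologicalType) (T : Type) (g : T -> X -> bool) d :
  (forall t, continuous (g t)) -> continuous (fun x => has (g^~ x) d).
Proof.
move=> cg; elim: d => [|t d IHd]; first exact: cst_continuous.
apply/continuous_boolP => x.
have /continuous_boolP/(_ x) := cg t; have /continuous_boolP/(_ x) := IHd.
by apply: filterS2 => y /= -> ->.
Qed.

Lemma cell_continuous d : continuous (cell d : cantor_space -> bool).
Proof.
apply: (@continuous_has cantor_space _ (fun w c => mkseq c (size w) == w)) => w.
apply/continuous_boolP => c; apply: filterS (near_agree (size w) c) => e ce.
congr (_ == _); apply/eq_in_map => i; rewrite mem_iota add0n => /andP[_ iw].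
by rewrite ce.
Qed.

Lemma continuous_cell (g : cantor_space -> bool) :
  continuous g -> exists d, g = cell d.
Proof.
move=> /cantor_bool_unif[m gm].
have gE (c : cantor_space) : g (nth false (mkseq c m)) = g c.
  by apply: gm => i im; rewrite nth_mkseq.
exists [seq w <- [seq tval t | t : m.-tuple bool] | g (nth false w)].
apply/funext => c; apply/idP/hasP => [gc|[w]].
  exists (mkseq c m); last by rewrite size_mkseq.
  rewrite mem_filter gE gc; apply/mapP.
  exists (mktuple (fun i : 'I_m => c i)); first by rewrite mem_enum.
  by rewrite /= /mkseq -val_enum_ord -map_comp.
rewrite mem_filter => /andP[gw /mapP[t _ wt]] /eqP.
have -> : size w = m by rewrite wt size_tuple.
by move=> cw; move: gw; rewrite -cw gE.
Qed.

Section ReturnTimes.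
Variable R : realType.
Local Notation C := cantor_space.
Implicit Types p q : homeo C * C.

(** The [n]-th point of the forward orbit of the base point. *)
Definition orbit_at p n : C := iter n (p.1 : C -> C) p.2.

(** The sequence of the codes of all the sets of return times
    [[set n | U (orbit_at p n)]], for [U] clopen; the numbers that code no list
    stand for the empty set. *)
Definition return_codes p : {ptws nat -> R} := fun k =>
  bitcode R (fun n => cell (odflt [::] (unpickle k)) (orbit_at p n)).

(** Evaluation being jointly continuous, return times depend continuously on
    the pointed system. *)
Lemma return_codes_continuous : continuous return_codes.
Proof.
move=> p; apply/(@pointwise_cvgP nat R) => k.
apply: (@bitcode_continuous R _
  (fun p n => cell (odflt [::] (unpickle k)) (orbit_at p n))) => n {}p.
apply: continuous_comp; last exact: cell_continuous.
by apply: continuous_iter_eval => x; [exact: cvg_fst|exact: cvg_snd].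
Qed.

Lemma range_return_codes p r :
  range (return_codes p) r <-> exists2 g : C -> bool, continuous g &
    r = bitcode R (fun n => g (orbit_at p n)).
Proof.
split=> [[k _ <-]|[g /continuous_cell[d ->] ->]].
  by exists (cell (odflt [::] (unpickle k))) => //; exact: cell_continuous.
by exists (pickle d) => //; rewrite /return_codes pickleK.
Qed.

Lemma orbit_conj p q (h : C -> C) :
  h \o p.1 = (q.1 : C -> C) \o h -> h p.2 = q.2 ->
  forall n, h (orbit_at p n) = orbit_at q n.
Proof.
move=> hpq h2; elim=> [//|n IHn].
by rewrite /orbit_at /= -[h _]/((h \o p.1) _) hpq /= IHn.
Qed.

Lemma orbit_dense_eq p (f g : C -> C) :
  dense (forward_orbit p.1 p.2) -> continuous f -> continuous g ->
  (forall n, f (orbit_at p n) = g (orbit_at p n)) -> f = g.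
Proof.
move=> dp /continuous_cantorP cf /continuous_cantorP cg fg.
apply/funext => c; apply/funext => i.
have /continuous_boolP/(_ c) fc := cf i.
have /continuous_boolP/(_ c) gc := cg i.
have : nbhs c [set d | f d i = f c i /\ g d i = g c i].
  by apply: filterS2 fc gc => d ? ?.
rewrite nbhsE => -[V [oV Vc] Vfg].
have [|d [/Vfg[fE gE] [n _ nE]]] := dp V _ oV; first by exists c.
by rewrite -fE -gE -nE; apply: (congr1 (fun d : C => d i)); exact: fg.
Qed.

Lemma pointed_conjugate_sym p q :
  pointed_conjugate p q -> pointed_conjugate q p.
Proof.
move=> [h [hpq h2]].
have [hc [g [hg gh gc]]] : homeomorphism (h : C -> C) := set_mem (valP h).
have hgC : homeomorphism g by split=> //; exists h.
exists (mk_homeo hgC); split; last by rewrite -h2; exact: (hg p.2).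
apply/funext => c /=; rewrite -[LHS]/(g (q.1 c)) -[RHS]/((p.1 : C -> C) (g c)).
rewrite -[RHS]hg; congr g; rewrite -[in LHS](gh c).
by rewrite -[RHS]/(((h : C -> C) \o p.1) (g c)) hpq.
Qed.

Lemma conj_return_codes p q : pointed_conjugate p q ->
  range (return_codes p) `<=` range (return_codes q).
Proof.
move=> /pointed_conjugate_sym[h [hqp h2]] r /range_return_codes[g cg ->].
apply/range_return_codes; exists (g \o h).
  by move=> c; apply: continuous_comp; [exact: homeo_continuous|exact: cg].
by congr bitcode; apply/funext => n /=; rewrite (orbit_conj hqp h2).
Qed.

(** The coordinates of the orbit of [p] are return times to clopen sets, so an
    inclusion of return time algebras gives a continuous equivariant map. *)
Lemma return_codes_factor p q :
  range (return_codes p) `<=` range (return_codes q) ->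
  exists2 h : C -> C, continuous h & forall n, h (orbit_at q n) = orbit_at p n.
Proof.
move=> pq.
have /choice[g gP] i : exists g : C -> bool, continuous g /\
    forall n, orbit_at p n i = g (orbit_at q n).
  have /pq/range_return_codes[g cg /bitcode_inj gE] :
      range (return_codes p) (bitcode R (fun n => orbit_at p n i)).
    apply/range_return_codes; exists (fun c : C => c i) => //.
    exact: continuous_coord.
  by exists g; split=> // n; rewrite -[LHS]/((fun n => orbit_at p n i) n) gE.
exists (fun c => (fun i => g i c) : C).
  by apply/continuous_cantorP => i; exact: (gP i).1.
by move=> n; apply/funext => i; rewrite (gP i).2.
Qed.

Lemma pointed_conjugate_return_codes p q :
  dense (forward_orbit p.1 p.2) -> dense (forward_orbit q.1 q.2) ->
  (pointed_conjugate p q <-> eq_plus (return_codes p) (return_codes q)).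
Proof.
move=> dp dq; split=> [pq|E].
  by apply/seteqP; split; apply: conj_return_codes => //;
    exact: pointed_conjugate_sym.
have [g cg gP] : exists2 h : C -> C, continuous h &
    forall n, h (orbit_at q n) = orbit_at p n.
  by apply: return_codes_factor; rewrite E.
have [h ch hP] : exists2 h : C -> C, continuous h &
    forall n, h (orbit_at p n) = orbit_at q n.
  by apply: return_codes_factor; rewrite E.
have hg : h \o g = id.
  apply: (orbit_dense_eq dq) => [c| |n].
  - by apply: continuous_comp; [exact: cg|exact: ch].
  - by move=> c; exact: cvg_id.
  - by rewrite /= gP hP.
have gh : g \o h = id.
  apply: (orbit_dense_eq dp) => [c| |n].
  - by apply: continuous_comp; [exact: ch|exact: cg].
  - by move=> c; exact: cvg_id.
  - by rewrite /= hP gP.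
have hh : homeomorphism h.
  split=> //; exists g; split=> // c.
    by rewrite -[LHS]/((g \o h) c) gh.
  by rewrite -[LHS]/((h \o g) c) hg.
exists (mk_homeo hh); split; last exact: (hP 0%N).
apply: (orbit_dense_eq dp) => [c|c|n].
- by apply: continuous_comp; [exact: homeo_continuous|exact: ch].
- by apply: continuous_comp; [exact: ch|exact: homeo_continuous].
- rewrite -[LHS]/(h (orbit_at p n.+1)) hP.
  by rewrite -[RHS]/(q.1 (h (orbit_at p n))) hP.
Qed.

End ReturnTimes.

(** * The codes of pointed systems with specification form a Borel set *)

Lemma exp_half_le (R : realType) (e : R) :
  (0 < e)%R -> exists m, (2^-1 ^+ m <= e)%R.
Proof.
move=> e0; have /cvgrPdist_le /(_ e e0) [m _ /(_ m (leqnn m))] :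
    ((2^-1 : R) ^+ n)%R @[n --> \oo] --> (0 : R)%R.
  by apply: cvg_expr; rewrite gtr0_norm ?invr_gt0 ?invf_lt1 ?ltr1n ?ltr0n.
by rewrite sub0r normrN ger0_norm ?exprn_ge0 ?invr_ge0// => h; exists m.
Qed.

Section SpecificationBorel.
Variable R : realType.
Local Notation C := cantor_space.

(** The sequence [w] extended by zeros; these points are dense. *)
Definition zero_tail (w : seq bool) : C := nth false w.

Lemma near_zero_tail (c : C) (A : set C) :
  nbhs c A -> exists w, A (zero_tail w).
Proof.
move=> /nbhs_cantorP[m mA]; exists (mkseq c m); apply: mA => i im.
by rewrite /zero_tail nth_mkseq.
Qed.

Lemma near_iter_agree (f : C -> C) (c : C) m N : continuous f ->
  \forall d \near c, forall j, (j < N)%N -> agree m (iter j f c) (iter j f d).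
Proof.
move=> cf; elim: N => [|N IHN]; first exact: filterE.
have cN : continuous (iter N f).
  elim: N {IHN} => [|N IHN] d; first exact: cvg_id.
  by apply: continuous_comp; [exact: IHN|exact: cf].
have := cN c _ (near_agree m (iter N f c)).
apply: filterS2 IHN => d IHd dN j; rewrite ltnS leq_eqVlt => /orP[/eqP ->//|].
exact: IHd.
Qed.

(** The orbit segments to be shadowed and the shadowing point may be taken among
    the countably many points with finitely many nonzero coordinates. *)
Lemma specificationP (f : C -> C) : continuous f ->
  @specification R C f <->
  forall m, exists k : nat, forall n (x : {ffun 'I_n -> seq bool})
    (a b : {ffun 'I_n -> nat}), (2 <= n)%N ->
    (forall i, a i < b i)%N ->
    (forall i j : 'I_n, j = i.+1 :> nat -> b i + k <= a j)%N ->
  exists w : seq bool, forall (i : 'I_n) (j : nat), (a i <= j < b i)%N ->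
    agree m (iter j f (zero_tail (x i))) (iter j f (zero_tail w)).
Proof.
move=> cf; split=> [spec m|spec e /exp_half_le[m me]].
  have [|k kP] := spec (2^-1 ^+ m)%R; first by rewrite exprn_gt0 ?invr_gt0.
  exists k => n x a b n2 ab abk.
  have [y yP] := kP n (fun i => zero_tail (x i)) a b n2 ab abk.
  have /near_zero_tail[w wP] : nbhs y [set d | forall j,
      (j < \max_i b i)%N -> agree m (iter j f y) (iter j f d)].
    exact: near_iter_agree.
  exists w => i j /[dup] aijb /andP[_ jb].
  have := yP i j aijb => /mdist_agree yj; apply: agree_trans yj _.
  by apply: wP; apply: leq_trans jb _; exact: leq_bigmax.
have [k kP] := spec m; exists k => n x a b n2 ab abk.
have /choice[w wP] i : exists w, forall j, (j < b i)%N ->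
    agree m (iter j f (x i)) (iter j f (zero_tail w)).
  exact: near_zero_tail (near_iter_agree (x i) m (b i) cf).
have [||v vP] := kP n [ffun i => w i] [ffun i => a i] [ffun i => b i] n2.
- by move=> i; rewrite !ffunE.
- by move=> i j; rewrite !ffunE; exact: abk.
exists (zero_tail v) => i j /[dup] aijb /andP[_ jb].
apply: le_trans me; apply/mdist_agree.
apply: agree_trans (wP i j jb) _.
by have := vP i j; rewrite !ffunE; apply.
Qed.

Lemma borel_map_iter (X : topologicalType) (f : X -> homeo C) (c : X -> C) n i :
  continuous f -> continuous c ->
  borel_map (fun x => iter n (f x : C -> C) (c x) i).
Proof.
move=> cf cc; apply: borel_map_continuous.
move: i; apply/continuous_cantorP; exact: continuous_iter_eval.
Qed.

Lemma borel_pointed_spec_systems : borel (pointed_spec_systems R).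
Proof.
have c1 : continuous (fun p : homeo C * C => p.1) by move=> p; exact: cvg_fst.
have c2 : continuous (fun p : homeo C * C => p.2) by move=> p; exact: cvg_snd.
apply: borelI.
  rewrite (_ : (fun _ => _) = [set p : homeo C * C |
    forall m, exists k : nat, forall n (x : {ffun 'I_n -> seq bool})
      (a b : {ffun 'I_n -> nat}), (2 <= n)%N ->
      (forall i, a i < b i)%N ->
      (forall i j : 'I_n, j = i.+1 :> nat -> b i + k <= a j)%N ->
    exists w : seq bool, forall (i : 'I_n) (j : nat), (a i <= j < b i)%N ->
      forall l, (l < m)%N ->
      iter j (p.1 : C -> C) (zero_tail (x i)) l =
      iter j (p.1 : C -> C) (zero_tail w) l]); last first.
    by apply/seteqP; split=> p /specificationP; apply; exact: homeo_continuous.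
  apply: borel_forall => m; apply: borel_exists => k; apply: borel_forall => n.
  apply: borel_forall => x; apply: borel_forall => a; apply: borel_forall => b.
  do 3!apply: borel_imply => _.
  apply: borel_exists => w; apply: borel_forall => i; apply: borel_forall => j.
  apply: borel_imply => _; apply: borel_forall => l; apply: borel_imply => _.
  have bm c : borel_map (fun p : homeo C * C => iter j (p.1 : C -> C) c l).
    apply: (@borel_map_iter _ (fun p => p.1) (fun=> c)) => //.
    exact: cst_continuous.
  exact: (borel_map_pair (bm _) (bm _) [set q | q.1 = q.2]).
rewrite (_ : (fun _ => _) = [set p : homeo C * C | forall w : seq bool,
    exists n : nat, mkseq (orbit_at p n) (size w) = w]).
  apply: borel_forall => w; apply: borel_exists => n.
  apply: (@borel_map_mkseq _ _ (fun p => orbit_at p n) (size w) _ [set w]) => i.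
  exact: borel_map_iter.
apply/seteqP; split=> p /= dp.
  move=> w.
  have [||d [wd [n _ nd]]] := dp [set d : C | agree (size w) (zero_tail w) d].
  - by exists (zero_tail w).
  - rewrite openE => d wd; apply: filterS (near_agree (size w) d) => e.
    exact: agree_trans.
  exists n; apply: (@eq_from_nth _ false); rewrite size_mkseq// => i iw.
  by rewrite nth_mkseq// -[LHS]/(iter n _ _ i) nd -wd.
move=> O [c Oc] oO.
have /nbhs_cantorP[m mO] : nbhs c O by exact: open_nbhs_nbhs.
have [n nE] := dp (mkseq c m); exists (orbit_at p n); split; last by exists n.
apply: mO => i im; move/(congr1 (fun w => nth false w i)): nE.
by rewrite size_mkseq !nth_mkseq.
Qed.

Lemma return_codes_reducible :
  borel_reducible (pointed_spec_systems R) (@pointed_conjugate C)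
    [set: {ptws nat -> R}] (@eq_plus R).
Proof.
split; [exact: borel_pointed_spec_systems|exact: borelT|].
exists (@return_codes R); split=> // [U bU|p q [_ dp] [_ dq]].
  apply: borelI; first exact: borel_pointed_spec_systems.
  apply: borel_preimage bU => V oV; apply: borel_open.
  by have /continuousP := @return_codes_continuous R; apply.
exact: pointed_conjugate_return_codes.
Qed.

End SpecificationBorel.

(** * A free family of subsets of the integers *)

Lemma injective_unbounded (h : nat -> nat) L :
  injective h -> exists k, (L <= h k)%N.
Proof.
move=> hI; apply: contrapT => /forallNP hL.
have : (size (mkseq h L.+1) <= size (iota 0 L))%N.
  apply: uniq_leq_size; first by rewrite mkseq_uniq.
  move=> _ /mapP[k _ ->]; rewrite mem_iota add0n /= ltnNge.
  by apply/negP; exact: hL.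
by rewrite size_mkseq size_iota ltnn.
Qed.

Section FreeFamily.
Variables (T : eqType) (s : T -> nat -> bool).
Hypothesis s_inj : injective s.

(** The [u]-th dyadic block [2^u, 2^u.+1) carries, for the datum
    [(_, m, ws, vs)] of code [u], the word of [vs] at the place where the prefix
    of length [m] of [s t] stands in [ws].  The first component of the datum
    makes each [(m, ws, vs)] occur in arbitrarily long blocks. *)
Definition block_word (u : nat) (t : T) : seq bool :=
  if (unpickle u : option (nat * nat * seq (seq bool) * seq (seq bool)))
    is Some (_, m, ws, vs)
  then nth [::] vs (index (mkseq (s t) m) ws) else [::].

(** The set of integers attached to [t]: the characters of [block_word u t] are
    written from [2 ^ u] on; it contains no negative integer. *)
Definition free_set (t : T) (p : int) : bool :=
  if p is Posz n then
    nth false (block_word (trunc_log 2 n) t) (n - 2 ^ trunc_log 2 n)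
  else false.

Lemma prefix_separation (ts : seq T) :
  exists m, {in ts &, injective (fun t => mkseq (s t) m)}.
Proof.
have /choice[d dP] (q : T * T) : exists i, q.1 <> q.2 -> s q.1 i <> s q.2 i.
  have [->|nq] := pselect (q.1 = q.2); first by exists 0%N.
  apply: contrapT => /forallNP h; apply: nq; apply: s_inj; apply/funext => i.
  by apply: contrapT => si; apply: (h i).
exists (\max_(q <- [seq (t, t') | t <- ts, t' <- ts]) d q).+1.
move=> t t' tts t'ts /= tt'; apply: contrapT => ntt'.
apply: (dP (t, t') ntt').
have lt : (d (t, t') <
    (\max_(q <- [seq (t, t') | t <- ts, t' <- ts]) d q).+1)%N.
  by rewrite ltnS; apply: leq_bigmax_seq => //; exact: allpairs_f.
by have := congr1 (fun w => nth false w (d (t, t'))) tt'; rewrite !nth_mkseq.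
Qed.

(** Any finite pattern for finitely many members of the family occurs
    simultaneously in them, at some nonnegative position. *)
Lemma free_set_pattern (ts : seq T) (M : nat) (f : T -> int -> bool) :
  exists j : nat, forall t (p : int), t \in ts -> (`|p| <= M)%N ->
    free_set t (p + j%:Z)%R = f t p.
Proof.
have [m mI] := prefix_separation ts.
pose L := (M + M).+1.
pose ws := [seq mkseq (s t) m | t <- ts].
pose vs := [seq mkseq (fun l => f t (l%:Z - M%:Z)%R) L | t <- ts].
(* [k] makes the block long enough to hold a word of length [L]. *)
have [k kL] := @injective_unbounded (fun k => pickle (k, m, ws, vs)) L
  ltac:(by move=> k k' /(pcan_inj pickleK)[]).
set u := pickle _ in kL.
(* The patterns on [-M, M] are written from the beginning of the block, so
   that their centre is at [2 ^ u + M]. *)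
exists (2 ^ u + M)%N => t p tts pM.
have [l [lL ->]] : exists l : nat, (l < L)%N /\ p = (l%:Z - M%:Z)%R.
  by exists `|(p + M%:Z)%R|%N; rewrite /L; lia.
have -> : (l%:Z - M%:Z + (2 ^ u + M)%N%:Z)%R = (2 ^ u + l)%N%:Z%R by lia.
have l2u : (l < 2 ^ u)%N.
  by apply: leq_trans lL _; apply: leq_trans kL _; rewrite ltnW// ltn_expl.
have uE : trunc_log 2 (2 ^ u + l) = u.
  by apply: trunc_log_eq => //; rewrite leq_addr expnS mul2n -addnn ltn_add2l.
rewrite /free_set uE addKn /block_word pickleK.
rewrite (_ : index _ ws = index t ts); last first.
  rewrite /ws; elim: ts mI tts {ws vs u kL l2u uE} => //= t' ts IHts mI.
  rewrite inE eq_sym => tts.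
  have -> : (mkseq (s t') m == mkseq (s t) m) = (t' == t).
    apply/eqP/eqP => [|->//]; apply: mI; rewrite inE ?eqxx//.
    by rewrite eq_sym.
  case: eqP tts => //= _ tts; congr _.+1; apply: IHts => //.
  by move=> v v' vts v'ts; apply: mI; rewrite inE ?vts ?v'ts orbT.
by rewrite (nth_map t) ?index_mem// nth_index// nth_mkseq.
Qed.

End FreeFamily.

(** * Enumerating a countable set without repetition *)

Section Tagging.
Variables (T : eqType) (u : nat -> T).

(** The [n]-th term of [u], tagged with the number of its earlier
    occurrences. *)
Definition occ_tagged n : T * nat :=
  (u n, count id (mkseq (fun m => u m == u n) n)).

Let occ t n := count (fun m => u m == t) (iota 0 n).

Let occ_taggedE n : occ_tagged n = (u n, occ (u n) n).
Proof. by rewrite /occ_tagged /mkseq count_map. Qed.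

Let occD t n k :
  occ t (n + k) = (occ t n + count (fun m => u m == t) (iota n k))%N.
Proof. by rewrite /occ iotaD count_cat add0n. Qed.

Lemma occ_tagged_inj : injective occ_tagged.
Proof.
have lt n n' : (n < n')%N -> occ_tagged n <> occ_tagged n'.
  move=> nn'; rewrite !occ_taggedE => -[<-]; rewrite -(subnKC nn') addSnnS occD.
  by rewrite /= eqxx; lia.
by move=> n n' nn'; have [/lt| /lt/nesym|] := ltngtP n n'.
Qed.

Lemma occ_tagged_surj t k : (forall n, exists2 n', (n <= n')%N & u n' = t) ->
  exists n, occ_tagged n = (t, k).
Proof.
move=> ut.
have next n : exists n', [/\ (n <= n')%N, u n' = t & occ t n' = occ t n].
  have en : exists n', (n <= n')%N && (u n' == t).
    by have [n' nn' /eqP un'] := ut n; exists n'; rewrite nn'.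
  case: (ex_minnP en) => n' /andP[nn' /eqP un'] n'min; exists n'; split=> //.
  rewrite -(subnKC nn') occD; apply/eqP; rewrite -[X in _ == X]addn0 eqn_add2l.
  rewrite -leqn0 leqNgt -has_count; apply/hasPn => m; rewrite mem_iota subnKC//.
  move=> /andP[nm mn']; apply/negP => um.
  by have := n'min m; rewrite nm um leqNgt mn' => /(_ isT).
elim: k => [|k [n]]; [have [n [_ un on]] := next 0%N|].
  by exists n; rewrite occ_taggedE un on.
rewrite occ_taggedE => -[un]; rewrite un => on.
have [n' [nn' un' on']] := next n.+1.
by exists n'; rewrite occ_taggedE un' on' -(addn1 n) occD /= un eqxx on addn1.
Qed.

End Tagging.

Section RealTags.
Variable R : realType.

(** Countably many bits that determine an element [(r, k)] of [R * nat]: bit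
    [(q, j)] says that [q < r] and [j = k]. *)
Definition rational_cut (t : R * nat) (i : nat) : bool :=
  if (unpickle i : option (rat * nat)) is Some (q, k) then
    (ratr q < t.1)%R && (k == t.2) else false.

Lemma rational_cut_inj : injective rational_cut.
Proof.
move=> [r k] [r' k'] E.
have {}E q j : (ratr q < r)%R && (j == k) = (ratr q < r')%R && (j == k').
  have := congr1 (fun b => b (pickle (q, j))) E.
  by rewrite /rational_cut pickleK.
have kk' : k = k'.
  have [q qr] : exists q : rat, (ratr q < r)%R.
    have [q] := @rat_in_itvoo R (r - 1)%R r ltac:(lra).
    by rewrite in_itv /= => /andP[_ qr]; exists q.
  by have := E q k; rewrite qr eqxx /= => /esym/andP[_ /eqP].
subst k'; have {}E q : (ratr q < r)%R = (ratr q < r')%R.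
  by have := E q k; rewrite eqxx !andbT.
congr (_, _); have [rr'|rr'|//] := ltgtP r r'.
  have [q] := rat_in_itvoo rr'; rewrite in_itv /= => /andP[rq qr'].
  by have := E q; rewrite qr' ltNge (ltW rq).
have [q] := rat_in_itvoo rr'; rewrite in_itv /= => /andP[rq qr'].
by have := E q; rewrite qr' ltNge (ltW rq).
Qed.

(** A sequence with the same range as [x] taking each of its values infinitely
    often, so that after tagging the range is [range x `*` setT], whatever the
    repetitions in [x].  Numbers that code no pair repeat [x 0]. *)
Definition repeated (x : nat -> R) (m : nat) : R :=
  x (if (unpickle m : option (nat * nat)) is Some (i, _) then i else 0%N).

Lemma range_occ_tagged x t : range (occ_tagged (repeated x)) t <-> range x t.1.
Proof.
case: t => r k; split=> /= [[n _ [<- _]]|[i _ <-]]; first by eexists.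
have [|n nE] := @occ_tagged_surj _ (repeated x) (x i) k; last by exists n.
move=> n.
have [j nj] := @injective_unbounded (fun j => pickle (i, j)) n
  ltac:(by move=> j j' /(pcan_inj pickleK)[]).
by exists (pickle (i, j)); rewrite // /repeated pickleK.
Qed.

End RealTags.

(** * The full shift with alphabet [{0, 1}^nat] *)

Lemma nat_int_bijection : exists (e : nat -> nat * int) (e' : nat * int -> nat),
  cancel e e' /\ cancel e' e.
Proof.
have /card_set_bijP[f] : ([set: nat * int] #= [set: nat])%card.
  apply: eq_card_nat; first exact: countableP.
  apply/infiniteP; rewrite -(card_le_eql (inj_card_eq (A := [set: nat])
    (f := fun n => (n, 0%R : int)) _)); last by move=> u v _ _ [].
  exact: subset_card_le.
by rewrite setTT_bijective => -[e fe ef]; exists e, f.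
Qed.

Lemma continuous_reindex (r : nat -> nat) :
  continuous ((fun c i => c (r i)) : cantor_space -> cantor_space).
Proof. by apply/continuous_cantorP => i; exact: continuous_coord. Qed.

Lemma homeomorphism_reindex (r r' : nat -> nat) : cancel r r' -> cancel r' r ->
  homeomorphism ((fun c i => c (r i)) : cantor_space -> cantor_space).
Proof.
move=> rK r'K; split; first exact: continuous_reindex.
exists (fun c i => c (r' i)); split; last exact: continuous_reindex.
- by move=> c; apply/funext => i; rewrite r'K.
- by move=> c; apply/funext => i; rewrite rK.
Qed.

Section Shift.
Variables (e : nat -> nat * int) (e' : nat * int -> nat).
Hypotheses (eK : cancel e e') (e'K : cancel e' e).
Local Notation C := cantor_space.

(** The coordinate [i] of a point of the Cantor space is the coordinate
    [(n, p) = e i] of a point of [{0, 1}^(nat * int)]; [shift_index d i] is the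
    index of the coordinate [(n, p + d)]. *)
Definition shift_index (d : int) (i : nat) : nat :=
  e' ((e i).1, ((e i).2 + d)%R).

Lemma shift_indexK d : cancel (shift_index d) (shift_index (- d)%R).
Proof.
by move=> i; rewrite /shift_index e'K /= addrK -surjective_pairing eK.
Qed.

(** The shift of [{0, 1}^(nat * int)] along [int], transported to the Cantor
    space. *)
Definition full_shift : homeo C := mk_homeo (homeomorphism_reindex
  (shift_indexK 1) (shift_indexK (-1))).

Lemma iter_shift j (c : C) i :
  iter j (full_shift : C -> C) c i = c (shift_index j i).
Proof.
elim: j i => [|j IHj] i.
  by rewrite /= /shift_index addr0 -surjective_pairing eK.
rewrite iterS -[LHS]/(iter j (full_shift : C -> C) c (shift_index 1 i)) IHj.
by rewrite /shift_index e'K /=; congr (c (e' (_, _))); lia.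
Qed.

(** The windows of [int] which a finite set of coordinates sees while the shift
    moves along two separated time intervals do not meet, so that prescribed
    orbit segments can be copied into a single point. *)
Lemma shift_specification (R : realType) : @specification R C full_shift.
Proof.
move=> eps /exp_half_le[m me].
pose M := \max_(i < m) `|(e i).2|%N.
have MP i : (i < m)%N -> (`|(e i).2| <= M)%N.
  move=> im.
  exact: (@leq_bigmax _ (fun i : 'I_m => `|(e i).2|%N) (Ordinal im)).
exists (M + M)%N => n x a b n2 ab abM.
have sep (l l' : 'I_n) : (l < l')%N -> (b l + (M + M) <= a l')%N.
  case: l l' => l ln [l' l'n] /=; elim: l' l'n => // l' IHl' l'n.
  rewrite ltnS leq_eqVlt => /orP[/eqP ll'|ll'].
    by apply: abM => /=; rewrite ll'.
  apply: leq_trans (IHl' (ltnW l'n) ll') _.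
  have := abM (Ordinal (ltnW l'n)) (Ordinal l'n) (erefl _).
  by have := ab (Ordinal (ltnW l'n)); lia.
pose sees (l : 'I_n) (p : int) :=
  ((a l)%:Z - M%:Z <= p < (b l)%:Z + M%:Z)%R.
have seesI l l' p : sees l p -> sees l' p -> l = l'.
  rewrite /sees => lp l'p; apply/val_inj.
  by have [/sep|/sep|//] := ltngtP l l'; lia.
pose y : C := fun i =>
  if [pick l | sees l (e i).2] is Some l then x l i else false.
exists y => l j ajb; apply: le_trans me; apply/mdist_agree => i im.
rewrite !iter_shift; set i' := shift_index _ _.
have li' : sees l (e i').2.
  by rewrite /sees /i' /shift_index e'K /=; have := MP i im; lia.
rewrite /y; case: pickP => [l' /seesI/(_ li') ->//|/(_ l)]; by rewrite li'.
Qed.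

Variable R : realType.
Local Notation sets := (free_set (@rational_cut R)).

(** The point of [{0, 1}^(nat * int)] whose rows are the members of the free
    family attached to the tagged terms of [x]. *)
Definition shift_point (x : {ptws nat -> R}) : C :=
  fun i => sets (occ_tagged (repeated x) (e i).1) (e i).2.

Lemma orbit_shift_point x j n (p : int) :
  iter j (full_shift : C -> C) (shift_point x) (e' (n, p)) =
  sets (occ_tagged (repeated x) n) (p + j%:Z)%R.
Proof. by rewrite iter_shift /shift_point /shift_index !e'K /=. Qed.

(** The orbit of [shift_point x] comes close to any point [c], at a time whose
    membership in any member of the free family that is not a row can be
    prescribed. *)
Lemma shift_point_pattern x (c : C) m (t : R * nat) (v : bool) :
  exists j : nat, agree m c (iter j (full_shift : C -> C) (shift_point x)) /\
    ((forall n, occ_tagged (repeated x) n <> t) -> sets t j = v).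
Proof.
pose N := (\max_(i < m) (e i).1).+1; pose M := \max_(i < m) `|(e i).2|%N.
pose ts := mkseq (occ_tagged (repeated x)) N.
have uts : uniq ts by rewrite mkseq_uniq//; exact: occ_tagged_inj.
pose f t' p := if t' \in ts then c (e' (index t' ts, p)) else v.
have [j jP] := free_set_pattern (@rational_cut_inj R) (t :: ts) M f.
exists j; split; last first.
  move=> xt; have := jP t 0%R; rewrite add0r mem_head => ->//.
  by rewrite /f; case: ifP => // /mapP[n _ /esym/xt].
move=> i im; rewrite -(eK i); case ei: (e i) => [n p].
have nN : (n < N)%N.
  rewrite ltnS -[n]/(n, p).1 -ei.
  exact: (@leq_bigmax _ (fun i : 'I_m => (e i).1) (Ordinal im)).
have pM : (`|p| <= M)%N.
  rewrite -[p]/(n, p).2 -ei.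
  exact: (@leq_bigmax _ (fun i : 'I_m => `|(e i).2|%N) (Ordinal im)).
have nts : occ_tagged (repeated x) n \in ts by rewrite map_f ?mem_iota.
rewrite orbit_shift_point jP//; last by rewrite in_cons nts orbT.
rewrite /f nts.
by rewrite -(nth_mkseq t _ nN) index_uniq ?size_mkseq.
Qed.

Lemma shift_point_dense x :
  dense (forward_orbit (full_shift : C -> C) (shift_point x)).
Proof.
move=> O [c Oc] oO.
have /nbhs_cantorP[m mO] : nbhs c O by exact: open_nbhs_nbhs.
have [j [cj _]] := shift_point_pattern x c m (0%R, 0%N) true.
exists (iter j (full_shift : C -> C) (shift_point x)).
by split; [exact: mO|exists j].
Qed.

(** The range of [x] is an invariant of pointed conjugacy: no clopen set has
    for return times a member of the free family that is not a row. *)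
Lemma shift_point_conj_range x x' :
  pointed_conjugate (full_shift, shift_point x) (full_shift, shift_point x') ->
  range x `<=` range x'.
Proof.
move=> /pointed_conjugate_sym[h [hs hx]] r xr.
apply: contrapT => nx'r.
have [n _ nr] := (range_occ_tagged x (r, 0%N)).2 xr.
(* [n] is a row carrying [(r, 0)], so the return times of the second base point
   to the clopen set where [g] is true are the nonnegative elements of
   [sets (r, 0)]. *)
pose g (c : C) := h c (e' (n, 0%R)).
have cg : continuous g.
  move=> c; apply: (@continuous_comp _ _ _ (h : C -> C) (fun d : C => d _)).
    exact: homeo_continuous.
  exact: continuous_coord.
have gP j : g (iter j (full_shift : C -> C) (shift_point x')) = sets (r, 0%N) j.
  rewrite /g (orbit_conj hs hx).
  by rewrite /orbit_at orbit_shift_point add0r nr.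
(* [g] is constant near the base point, but the orbit comes back there at a
   time [j] whose membership in [sets (r, 0)] can be prescribed. *)
have /continuous_boolP/(_ (shift_point x'))/nbhs_cantorP[m gm] := cg.
have [j [ja jv]] := @shift_point_pattern x' (shift_point x') m (r, 0%N)
  (~~ g (shift_point x')).
have : sets (r, 0%N) j = ~~ g (shift_point x').
  apply: jv => k xk; apply: nx'r.
  by apply/(range_occ_tagged x' (r, 0%N)); exists k.
by rewrite -gP (gm _ ja); case: (g _).
Qed.

Lemma range_shift_point_conj x x' : range x = range x' ->
  pointed_conjugate (full_shift, shift_point x) (full_shift, shift_point x').
Proof.
have reindex (u v : {ptws nat -> R}) : range u = range v ->
    exists r, forall n,
      occ_tagged (repeated v) (r n) = occ_tagged (repeated u) n.
  move=> uv.
  have /choice[r rP] n : exists k,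
      occ_tagged (repeated v) k = occ_tagged (repeated u) n.
    have /range_occ_tagged[k _ kE] : range v (occ_tagged (repeated u) n).1.
      by rewrite -uv; apply/range_occ_tagged; exists n.
    by exists k.
  by exists r.
move=> /[dup] /reindex[r rP] /esym/reindex[r' r'P].
have rK : cancel r r'.
  by move=> n; apply: (@occ_tagged_inj _ (repeated x)); rewrite r'P rP.
have r'K : cancel r' r.
  by move=> n; apply: (@occ_tagged_inj _ (repeated x')); rewrite rP r'P.
(* The conjugacy permutes the rows. *)
pose row (r : nat -> nat) i := e' (r (e i).1, (e i).2).
have rowK s s' : cancel s s' -> cancel (row s) (row s').
  by move=> sK i; rewrite /row e'K /= sK -surjective_pairing eK.
exists (mk_homeo (homeomorphism_reindex (rowK _ _ r'K) (rowK _ _ rK))); split.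
  apply/funext => c; apply/funext => i.
  rewrite -[LHS]/(c (shift_index 1 (row r' i))).
  by rewrite -[RHS]/(c (row r' (shift_index 1 i))) /shift_index /row !e'K.
apply/funext => i; rewrite -[LHS]/(shift_point x (row r' i)).
by rewrite /shift_point /row e'K /= r'P.
Qed.

End Shift.

(** * The pointed shift is a Borel function of the sequence *)

(** The Cantor space is second countable, so that Borel measurability can be
    checked on the coordinates. *)
Lemma borel_preimage_cantor (X : topologicalType) (h : X -> cantor_space)
    (V : set cantor_space) :
  (forall i, borel_map (fun x => h x i)) -> open V -> borel (h @^-1` V).
Proof.
move=> bh oV; rewrite (_ : _ @^-1` _ = [set x | exists w : seq bool,
    (forall c, agree (size w) (zero_tail w) c -> V c) /\
    mkseq (h x) (size w) = w]).
  apply: borel_exists => w; apply: (@borelI _ [set x | _]).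
    have [wV|nwV] := pselect (forall c, agree (size w) (zero_tail w) c -> V c).
      by rewrite (_ : [set _ | _] = setT); [exact: borelT|apply/seteqP; split].
    rewrite (_ : [set _ | _] = set0); first exact: sigma_algebra0.
    by apply/seteqP; split.
  exact: (@borel_map_mkseq _ _ h (size w) bh [set w]).
apply/seteqP; split=> x /= => [Vhx|[w [wV hw]]].
  have /nbhs_cantorP[m mV] : nbhs (h x) V by exact: open_nbhs_nbhs.
  exists (mkseq (h x) m); rewrite size_mkseq; split=> // c hc.
  apply: mV => i im.
  by rewrite -hc// /zero_tail nth_mkseq.
by apply: wV => i iw; rewrite /zero_tail -[in LHS]hw nth_mkseq.
Qed.

Section ShiftBorel.
Variable R : realType.
Local Notation X := {ptws nat -> R}.

Lemma borel_map_cut (q : rat) i : borel_map (fun x : X => (ratr q < x i)%R).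
Proof.
apply: borel_map_fiber => b.
have bt : borel [set x : X | (ratr q < x i)%R].
  apply: borel_open.
  have /continuousP/(_ _ (@open_gt R (ratr q))) : continuous (fun x : X => x i).
    exact: (@proj_continuous nat (fun=> R)).
  by [].
case: b; first exact: bt.
rewrite (_ : [set _ | _] =
    ~` [set x : X | (ratr q < x i)%R]); first exact: borelC.
by apply/seteqP; split=> x /= => [->//|/negP/negbTE].
Qed.

Lemma borel_map_eq i j : borel_map (fun x : X => x i == x j).
Proof.
have beq : borel [set x : X | x i = x j].
  rewrite (_ : [set _ | _] = [set x : X | forall q : rat,
      (ratr q < x i)%R = (ratr q < x j)%R]).
    apply: borel_forall => q.
    exact: (borel_map_pair (borel_map_cut q i) (borel_map_cut q j)
      [set b | b.1 = b.2]).
  apply/seteqP; split=> x /= => [-> //|cut].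
  suff : (x i, 0%N) = (x j, 0%N) by case.
  apply: rational_cut_inj; apply/funext => n; rewrite /rational_cut.
  by case: unpickle => [[q k]|]//=; rewrite cut.
apply: borel_map_fiber => -[].
  rewrite (_ : [set _ | _] = [set x : X | x i = x j]); first exact: beq.
  by apply/seteqP; split=> x /= /eqP.
rewrite (_ : [set _ | _] = ~` [set x : X | x i = x j]); first exact: borelC.
by apply/seteqP; split=> x /= => [/negbT/eqP|/eqP/negbTE].
Qed.

Lemma borel_map_tag_cut n i :
  borel_map (fun x : X => rational_cut (occ_tagged (repeated x) n) i).
Proof.
rewrite /rational_cut; case: unpickle => [[q k]|]; last exact: borel_map_cst.
have bocc : borel_map (fun x : X => (occ_tagged (repeated x) n).2).
  apply: (@borel_map_comp _ _ _ (count id)).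
  apply: (@borel_map_mkseq _ _
    (fun (x : X) m => repeated x m == repeated x n)) => m.
  exact: borel_map_eq.
exact: (borel_map_comp (fun t => t.1 && (k == t.2))
  (borel_map_pair (borel_map_cut q _) bocc)).
Qed.

Lemma borel_map_free_set n p :
  borel_map (fun x : X =>
    free_set (@rational_cut R) (occ_tagged (repeated x) n) p).
Proof.
case: p => [p|p]; last exact: borel_map_cst.
rewrite /free_set /block_word.
case: unpickle => [[[[_ m] ws] vs]|]; last exact: borel_map_cst.
apply: (@borel_map_comp _ _ _
  (fun w => nth false (nth [::] vs (index w ws)) _)).
apply: (@borel_map_mkseq _ _
  (fun x : X => rational_cut (occ_tagged (repeated x) n))) => i.
exact: borel_map_tag_cut.
Qed.

Lemma shift_point_reducible :
  borel_reducible [set: X] (@eq_plus R)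
    (pointed_spec_systems R) (@pointed_conjugate cantor_space).
Proof.
have [e [e' [eK e'K]]] := nat_int_bijection.
split; [exact: borelT|exact: borel_pointed_spec_systems|].
exists (fun x => (full_shift eK e'K, shift_point e x)); split.
- move=> U bU; rewrite setTI; apply: borel_preimage bU => V oV.
  pose sV := [set c | V (full_shift eK e'K, c)].
  apply: (@borel_preimage_cantor _ (@shift_point e R) sV) => [i|].
    exact: borel_map_free_set.
  have /continuousP : continuous (fun c : cantor_space =>
      (full_shift eK e'K, c)).
    move=> c W [[A B] /= [nA nB] ABW]; apply: filterS nB => d Bd.
    by apply: ABW; split=> //=; exact: nbhs_singleton nA.
  exact.
- by move=> x _; split; [exact: shift_specification|exact: shift_point_dense].
- move=> x x' _ _; split; first exact: range_shift_point_conj.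
  move=> xx'; apply/seteqP; split.
    exact: shift_point_conj_range xx'.
  exact: shift_point_conj_range (pointed_conjugate_sym xx').
Qed.

End ShiftBorel.

Theorem corollary8p7 (R : realType) :
  borel_bireducible (pointed_spec_systems R) (@pointed_conjugate cantor_space)
    [set: {ptws nat -> R}] (@eq_plus R).
Proof.
by split; [exact: return_codes_reducible|exact: shift_point_reducible].
Qed.
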